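(* Let $A$ be an integral domain. If the polynomial ring $A[X_1,\dots,X_n]$ is a graded perinormal domain with the natural $\mathbb{Z}_{\geq0}^n$-grading, then $A$ is a perinormal domain.
   Context: The natural $\mathbb{Z}_{\ge0}^n$-grading on $A[X_1,\dots,X_n]$ has degree $(z_1,\dots,z_n)$ component $AX_1^{z_1}\cdots X_n^{z_n}$ (and is regarded as a $\mathbb{Z}^n$-grading with zero components in the remaining degrees). The graded quotient field of a graded domain $R$ is $R_H$, where $H$ is the set of nonzero homogeneous elements; $f/g$ (with $f,g$ homogeneous, $g\neq0$) has degree $\deg f-\deg g$. A graded overring of $R$ is a graded subring of $R_H$ containing $R$. $h\text{-Spec}$ denotes the set of graded (homogeneous) prime ideals. A graded maximal ideal is an ideal maximal among proper graded ideals; a graded domain is gr-local if it has exactly one graded maximal ideal. A graded overring $S$ of $R$ satisfies gGD (graded going-down) if whenever $P,Q\in h\text{-Spec}(R)$ and $\tilde Q\in h\text{-Spec}(S)$ with $P\subseteq Q$ and $\tilde Q\cap R=Q$, there exists $\tilde P\in h\text{-Spec}(S)$ with $\tilde P\subseteq\tilde Q$ and $\tilde P\cap R=P$. A graded domain $R$ is a graded perinormal domain if every gr-local graded overring of $R$ satisfying gGD over $R$ is a localization of $R$. An overring of an integral domain $A$ is a ring between $A$ and its quotient field; it is a going-down overring if the extension satisfies going-down. $A$ is perinormal if every local (i.e. having a unique maximal ideal) going-down overring of $A$ is a localization of $A$. A localization of a domain $R$ is a ring $R_W$ with $W$ a multiplicative subset of $R$. *)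

(* Defs.v *)
From HB Require Import structures.
From mathcomp Require Import all_boot all_order all_algebra.
From mathcomp Require Import boolp classical_sets.
From mathcomp Require Import mpoly.

Set Implicit Arguments.
Unset Strict Implicit.
Unset Printing Implicit Defensive.

Import GRing.Theory.
Local Open Scope classical_set_scope.
Local Open Scope ring_scope.

(* An integral domain R is identified with its image [base_ring R] in its     *)
(* quotient field {fraction R}, so that R, its overrings and all their ideals *)
(* are subsets of one field K.                                                *)

Section Subrings.
Variable K : fieldType.
Implicit Types R S I P Q W : set K.

Definition is_subring S : Prop :=
  [/\ S 1, forall x y, S x -> S y -> S (x - y)
    & forall x y, S x -> S y -> S (x * y)].

Definition is_ideal S I : Prop :=
  [/\ I `<=` S, I 0, forall x y, I x -> I y -> I (x + y)
    & forall a x, S a -> I x -> I (a * x)].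

Definition is_proper_ideal S I : Prop := is_ideal S I /\ I <> S.

Definition is_prime_ideal S P : Prop :=
  is_proper_ideal S P /\
  forall x y, S x -> S y -> P (x * y) -> P x \/ P y.

Definition is_maximal_ideal S M : Prop :=
  is_proper_ideal S M /\
  forall I, is_proper_ideal S I -> M `<=` I -> I = M.

Definition is_local S : Prop := exists! M, is_maximal_ideal S M.

Definition is_multiplicative R W : Prop :=
  [/\ W `<=` R, W 1 & forall x y, W x -> W y -> W (x * y)].

(* The condition ~ W 0 excludes the zero ring, which is not a subring of K,   *)
(* and is needed because x / 0 = 0 here.                                      *)
Definition is_localization R S : Prop :=
  exists W, [/\ is_multiplicative R W, ~ W 0
    & S = [set x | exists r w, [/\ R r, W w & x = r / w]]].

Definition going_down R S : Prop :=
  forall P Q Q', is_prime_ideal R P -> is_prime_ideal R Q ->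
    is_prime_ideal S Q' -> P `<=` Q -> Q' `&` R = Q ->
    exists P', [/\ is_prime_ideal S P', P' `<=` Q' & P' `&` R = P].

End Subrings.

Definition base_ring (R : idomainType) : set {fraction R} :=
  range (@tofrac R).
Arguments base_ring : clear implicits.

Definition is_overring (R : idomainType) (S : set {fraction R}) : Prop :=
  is_subring S /\ base_ring R `<=` S.

Definition perinormal (A : idomainType) : Prop :=
  forall S : set {fraction A},
    is_overring S -> is_local S -> going_down (base_ring A) S ->
    is_localization (base_ring A) S.

(* R is the internal direct sum of the additive subgroups gr_comp d, d in G.  *)
Record grading (G : zmodType) (R : nzRingType) := Grading {
  gr_comp :> G -> set R;
  gr_comp0 : forall d, gr_comp d 0;
  gr_compB : forall d x y, gr_comp d x -> gr_comp d y -> gr_comp d (x - y);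
  gr_comp1 : gr_comp 0 1;
  gr_compM : forall d e x y,
    gr_comp d x -> gr_comp e y -> gr_comp (d + e) (x * y);
  gr_comp_span : forall x, exists (s : seq G) (c : G -> R),
    [/\ uniq s, forall d, gr_comp d (c d) & x = \sum_(d <- s) c d];
  gr_comp_direct : forall (s : seq G) (c : G -> R),
    uniq s -> (forall d, gr_comp d (c d)) -> \sum_(d <- s) c d = 0 ->
    forall d, d \in s -> c d = 0
}.

Section GradedDomain.
Variables (G : zmodType) (R : idomainType) (gr : grading G R).
Local Notation K := {fraction R}.
Implicit Types S I P Q M : set K.

Definition gr_fraction (d : G) : set K :=
  [set x | exists a b f g, [/\ gr a f, gr b g, g != 0, d = a - b
                             & x = tofrac f / tofrac g]].

Definition homogeneous : set K := [set x | exists d, gr_fraction d x].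

(* The graded quotient field R_H. *)
Definition gr_quotient_field : set K :=
  [set x | exists f g, [/\ exists b, gr b g, g != 0 & x = tofrac f / tofrac g]].

(* I is the sum of its intersections with the components of R_H. *)
Definition is_graded I : Prop :=
  forall x, I x -> exists s : seq K,
    (forall y, y \in s -> I y /\ homogeneous y) /\ x = \sum_(y <- s) y.

Definition is_gr_overring S : Prop :=
  [/\ is_overring S, S `<=` gr_quotient_field & is_graded S].

Definition is_gr_prime S P : Prop := is_prime_ideal S P /\ is_graded P.

Definition is_gr_maximal S M : Prop :=
  [/\ is_proper_ideal S M, is_graded M
    & forall I, is_proper_ideal S I -> is_graded I -> M `<=` I -> I = M].

Definition is_gr_local S : Prop := exists! M, is_gr_maximal S M.

Definition gr_going_down S : Prop :=
  forall P Q Q', is_gr_prime (base_ring R) P -> is_gr_prime (base_ring R) Q ->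
    is_gr_prime S Q' -> P `<=` Q -> Q' `&` base_ring R = Q ->
    exists P', [/\ is_gr_prime S P', P' `<=` Q' & P' `&` base_ring R = P].

Definition gr_perinormal : Prop :=
  forall S, is_gr_overring S -> is_gr_local S -> gr_going_down S ->
    is_localization (base_ring R) S.

End GradedDomain.

Section NaturalGrading.
Variables (A : idomainType) (n : nat).
Local Notation Zn := {ffun 'I_n -> int}.

(* The degree d component is A X^d if d >= 0, and 0 otherwise. *)
Definition mpoly_comp (d : Zn) : set {mpoly A[n]} :=
  [set p | p = 0 \/ exists (a : A) (m : 'X_{1..n}),
                      (forall i, d i = (m i)%:Z) /\ p = a *: 'X_[m]].

Definition mdegZ (m : 'X_{1..n}) : Zn := [ffun i => (m i)%:Z].
Definition absm (d : Zn) : 'X_{1..n} := [multinom `|d i|%N | i < n].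

Lemma mdegZK m : absm (mdegZ m) = m.
Proof. by apply/mnmP => i; rewrite mnmE ffunE. Qed.

Lemma mpoly_compP d p : mpoly_comp d p <->
  forall m, p@_m != 0 -> d = mdegZ m.
Proof.
split=> [[->|[a [m [dm ->]]]] k|H].
- by rewrite mcoeff0 eqxx.
- rewrite mcoeffZ mcoeffX; have [<- _|_] := eqVneq m k;
    last by rewrite mulr0 eqxx.
  by apply/ffunP => i; rewrite dm ffunE.
have [->|/eqP p0] := eqVneq p 0; first by left.
right; exists p@_(absm d), (absm d).
have [m pm] : exists m, p@_m != 0.
  apply: contrapT => /forallNP E; apply: p0; apply/mpolyP => m.
  by rewrite mcoeff0; apply/eqP/negPn/negP/E.
have dm := H _ pm; split=> [i|]; first by rewrite dm mdegZK ffunE.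
apply/mpolyP => k; rewrite mcoeffZ mcoeffX.
case: eqP => [->|ne]; rewrite ?mulr1 ?mulr0 //.
apply/eqP/negPn/negP => /H E; by apply: ne; rewrite E mdegZK.
Qed.

Lemma mpoly_comp0 d : mpoly_comp d 0. Proof. by left. Qed.

Lemma mpoly_compB d p q :
  mpoly_comp d p -> mpoly_comp d q -> mpoly_comp d (p - q).
Proof.
move=> /mpoly_compP Hp /mpoly_compP Hq; apply/mpoly_compP => m.
rewrite mcoeffB; have [->|/Hp //] := eqVneq p@_m 0.
by rewrite sub0r oppr_eq0 => /Hq.
Qed.

Lemma mpoly_comp1 : mpoly_comp 0 1.
Proof.
right; exists 1, 0%MM; rewrite scale1r mpolyX0; split=> // i.
by rewrite ffunE mnm0E.
Qed.

Lemma mpoly_compM d e p q :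
  mpoly_comp d p -> mpoly_comp e q -> mpoly_comp (d + e) (p * q).
Proof.
move=> [->|[a [m [dm ->]]]]; first by left; rewrite mul0r.
move=> [->|[b [k [ek ->]]]]; first by left; rewrite mulr0.
right; exists (a * b), (m + k)%MM; split=> [i|].
  by rewrite ffunE dm ek mnmDE PoszD.
by rewrite mpolyXD -scalerAl -scalerAr scalerA.
Qed.

Lemma mpoly_comp_span p : exists (s : seq Zn) (c : Zn -> {mpoly A[n]}),
  [/\ uniq s, forall d, mpoly_comp d (c d) & p = \sum_(d <- s) c d].
Proof.
exists (map mdegZ (msupp p)).
exists (fun d => if mdegZ (absm d) == d
                 then p@_(absm d) *: 'X_[absm d] else 0).
split=> [|d|].
- by rewrite (map_inj_uniq (can_inj mdegZK)) msupp_uniq.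
- case: eqP => [E|_]; last by left.
  right; exists p@_(absm d), (absm d); split=> [i|] //.
  by rewrite -{1}E ffunE.
rewrite big_map {1}[p]mpolyE; apply: eq_bigr => m _.
by rewrite mdegZK eqxx.
Qed.

Lemma mpoly_comp_direct (s : seq Zn) (c : Zn -> {mpoly A[n]}) :
  uniq s -> (forall d, mpoly_comp d (c d)) -> \sum_(d <- s) c d = 0 ->
  forall d, d \in s -> c d = 0.
Proof.
move=> us Hc S0 d ds; apply/mpolyP => m; rewrite mcoeff0.
apply/eqP/negPn/negP => nz; have /mpoly_compP /(_ m nz) dm := Hc d.
move: (congr1 (mcoeff m) S0); rewrite mcoeff0 (bigD1_seq d) //= mcoeffD.
rewrite raddf_sum /= big1 ?addr0 => [E|e ne]; first by rewrite E eqxx in nz.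
apply/eqP/negPn/negP => nz'; have /mpoly_compP /(_ m nz') em := Hc e.
by rewrite em dm eqxx in ne.
Qed.

Definition mpoly_grading : grading Zn {mpoly A[n]} :=
  Grading mpoly_comp0 mpoly_compB mpoly_comp1 mpoly_compM
    mpoly_comp_span mpoly_comp_direct.

End NaturalGrading.

(* Main.v *)
Require Import Defs.
From HB Require Import structures.
From mathcomp Require Import all_boot all_order all_algebra.
From mathcomp Require Import boolp classical_sets.
From mathcomp Require Import mpoly.

Set Implicit Arguments.
Unset Strict Implicit.
Unset Printing Implicit Defensive.

Import GRing.Theory.
Local Open Scope classical_set_scope.
Local Open Scope quotient_scope.
Local Open Scope ring_scope.

(** The theorem is a transfer from [A] to [A[X_1, ..., X_n]].  Let [S] be a local
going-down overring of [A].  The claim is that [S[X]], inside the quotient field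
of [A[X]], is a gr-local graded overring of [A[X]] satisfying graded going-down;
graded perinormality then makes it a localization of [A[X]], and the
localization descends to degree 0.

The point is that graded primes of [S[X]] see almost only primes of [S].  If [P]
is graded, membership of [f] in [P] can be tested on the monomials [c X^m] of
[f]; if [P] is also prime, then [c X^m] is in [P] iff [c] is in [P], or some
[X_i] in [P] divides [X^m].  Thus [P] is determined by the prime [p] of its
constants and the set [E] of the variables that it contains
([gr_prime_mono]).  Conversely each pair [(p, E)] gives a graded prime
([mono_ideal_prime]).  Intersecting with [A[X]] intersects [p] with [A] and
leaves [E] unchanged, so going-down for [A] inside [S] gives graded going-down
for [A[X]] inside [S[X]]: go down on [p] and take the smaller [E]
([poly_over_gr_going_down]).

Likewise a proper graded ideal lies in the ideal generated by its constants and
all the variables, so that graded maximal ideals of [S[X]] correspond to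
maximal ideals of [S] ([poly_over_gr_local]).  Finally, if [S[X]] is [A[X]]
localized at [W], then every [w] in [W] is a unit of [S[X]], hence a constant, and
[S] is [A] localized at the constants in [W] ([poly_over_localization]).

All these rings live in the quotient field of [A[X]].  The polynomial ring over
the quotient field [F] of [A] is embedded in it by [emb], so that a graded
submodule is described by the coefficients allowed in each degree
([coefset]). *)

(** * Fractions and the extension of morphisms to quotient fields *)

Lemma fracE (R : idomainType) (x : {fraction R}) :
  x = tofrac \n_(repr x) / tofrac \d_(repr x).
Proof.
rewrite -[x in LHS]reprK; move: (repr x) => r.
apply: (mulIf (x := tofrac \d_r)); first by rewrite tofrac_eq0 denom_ratioP.
rewrite divfK ?tofrac_eq0 ?denom_ratioP //.
rewrite -[X in X * _]/(\pi_(FracField.type R) r); unlock tofrac.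
rewrite -[LHS]FracField.pi_mul.
apply/eqmodP; rewrite /= /FracField.equivf /FracField.mulf.
by rewrite !numden_Ratio ?mulf_neq0 ?oner_neq0 ?denom_ratioP //= !mulr1 mulrC.
Qed.

Section FracLift.
Variables (R : idomainType) (L : fieldType) (phi : {rmorphism R -> L}).
Hypothesis phi_inj : injective phi.

Definition frac_lift (x : {fraction R}) : L :=
  phi \n_(repr x) / phi \d_(repr x).

Let phi_neq0 a : a != 0 -> phi a != 0.
Proof. by rewrite -(inj_eq phi_inj) rmorph0. Qed.

Lemma frac_liftE a b : b != 0 ->
  frac_lift (tofrac a / tofrac b) = phi a / phi b.
Proof.
move=> b0; rewrite /frac_lift; set x := tofrac a / _.
have d0 : \d_(repr x) != 0 by exact: denom_ratioP.
apply/eqP; rewrite eqr_div ?phi_neq0 // -!rmorphM; apply/eqP; congr (phi _).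
apply/eqP; rewrite -tofrac_eq !rmorphM /= -eqr_div ?tofrac_eq0 //.
by rewrite -fracE.
Qed.

Lemma frac_lift_tofrac a : frac_lift (tofrac a) = phi a.
Proof.
by have := frac_liftE a (oner_neq0 R); rewrite !rmorph1 !divr1.
Qed.

Lemma frac_lift_is_zmod_morphism : zmod_morphism frac_lift.
Proof.
move=> x y; rewrite [x]fracE [y]fracE.
set a := \n_(repr x); set c := \n_(repr y).
have b0 : \d_(repr x) != 0 by exact: denom_ratioP.
have d0 : \d_(repr y) != 0 by exact: denom_ratioP.
move: b0 d0; set b := \d_(repr x); set d := \d_(repr y) => b0 d0.
rewrite -mulNr addf_div ?tofrac_eq0 // -tofracN -!tofracM -tofracD.
rewrite !frac_liftE ?mulf_neq0 // rmorphD !rmorphM rmorphN.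
by rewrite -mulNr addf_div ?phi_neq0.
Qed.

Lemma frac_lift_is_monoid_morphism : monoid_morphism frac_lift.
Proof.
split; first by rewrite -[1]tofrac1 frac_lift_tofrac rmorph1.
move=> x y; rewrite [x]fracE [y]fracE.
set a := \n_(repr x); set c := \n_(repr y).
have b0 : \d_(repr x) != 0 by exact: denom_ratioP.
have d0 : \d_(repr y) != 0 by exact: denom_ratioP.
move: b0 d0; set b := \d_(repr x); set d := \d_(repr y) => b0 d0.
rewrite mulf_div -!tofracM !frac_liftE ?mulf_neq0 // !rmorphM.
by rewrite -mulf_div.
Qed.

End FracLift.

(** * Subrings and ideals of a field *)

Section SubringTheory.
Variable K : fieldType.
Implicit Types S I P : set K.

Lemma subring0 S : is_subring S -> S 0.
Proof. by case=> S1 SB _; rewrite -(subrr 1); exact: SB. Qed.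

Lemma subringD S x y : is_subring S -> S x -> S y -> S (x + y).
Proof.
move=> rS Sx Sy; have [_ SB _] := rS; rewrite -[y]opprK; apply: (SB) => //.
by rewrite -sub0r; apply: SB => //; exact: subring0.
Qed.

Lemma ideal_properP S I : is_subring S ->
  is_proper_ideal S I <-> is_ideal S I /\ ~ I 1.
Proof.
move=> [S1 _ _]; split=> -[iI nI]; split=> //.
- move=> I1; apply: nI; case: iI => IS _ _ IM; apply/seteqP; split=> // x Sx.
  by rewrite -[x]mulr1; exact: IM.
- by move=> E; apply: nI; rewrite E.
Qed.

End SubringTheory.

(** * Embedding polynomials over Frac A in Frac A[X] *)

Section Polynomials.
Variables (A : idomainType) (n : nat).
Local Notation F := {fraction A}.
Local Notation K := {fraction {mpoly A[n]}}.
Local Notation FX := {mpoly F[n]}.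
Local Notation gr := (mpoly_grading A n).
Implicit Types (S p q I : set F) (P Q M : set K) (E : pred 'I_n).

Definition const_frac (a : A) : K := tofrac (a%:MP_[n]).

Lemma const_frac_is_zmod_morphism : zmod_morphism const_frac.
Proof. by move=> a b; rewrite /const_frac mpolyCB tofracB. Qed.

Lemma const_frac_is_monoid_morphism : monoid_morphism const_frac.
Proof.
by split=> [|a b]; rewrite /const_frac ?mpolyC1 ?tofrac1 ?mpolyCM ?tofracM.
Qed.

HB.instance Definition _ :=
  GRing.isZmodMorphism.Build A K const_frac const_frac_is_zmod_morphism.
HB.instance Definition _ :=
  GRing.isMonoidMorphism.Build A K const_frac const_frac_is_monoid_morphism.

Lemma const_frac_inj : injective const_frac.
Proof.
by move=> a b /eqP; rewrite /const_frac tofrac_eq mpolyC_eq => /eqP.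
Qed.

Definition scalar : F -> K := frac_lift const_frac.

HB.instance Definition _ := GRing.isZmodMorphism.Build F K scalar
  (frac_lift_is_zmod_morphism const_frac_inj).
HB.instance Definition _ := GRing.isMonoidMorphism.Build F K scalar
  (frac_lift_is_monoid_morphism const_frac_inj).

Lemma scalar_tofrac a : scalar (tofrac a) = tofrac (a%:MP_[n]).
Proof. exact: (frac_lift_tofrac const_frac_inj). Qed.

Definition emb (f : FX) : K :=
  mmap scalar (fun i => tofrac ('X_i : {mpoly A[n]})) f.

Lemma emb_is_zmod_morphism : zmod_morphism emb.
Proof. by move=> f g; exact: mmapB. Qed.

Lemma emb_is_monoid_morphism : monoid_morphism emb.
Proof. by split=> [|f g]; [exact: rmorph1|exact: rmorphM]. Qed.

HB.instance Definition _ :=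
  GRing.isZmodMorphism.Build FX K emb emb_is_zmod_morphism.
HB.instance Definition _ :=
  GRing.isMonoidMorphism.Build FX K emb emb_is_monoid_morphism.

Lemma embC (c : F) : emb c%:MP = scalar c.
Proof. exact: mmapC. Qed.

Lemma emb_map (f : {mpoly A[n]}) : emb (map_mpoly (@tofrac A) f) = tofrac f.
Proof.
elim/mpolyind: f => [|c m f _ _ IH]; first by rewrite !rmorph0.
rewrite !rmorphD /= IH; congr (_ + _).
rewrite map_mpolyZ map_mpolyX /emb mmapZ mmapX /= scalar_tofrac.
rewrite -mul_mpolyC tofracM [in RHS]mpolyXE_id rmorph_prod /mmap1 /=.
by congr (_ * _); apply: eq_bigr => i _; rewrite tofracXn.
Qed.

(** Clearing denominators: this is what makes [emb] injective, and what puts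
[S[X]] inside the graded quotient field of [A[X]]. *)
Lemma common_denom (f : FX) : exists d g, d != 0 /\
  tofrac d *: f = map_mpoly (@tofrac A) g.
Proof.
elim/mpolyind: f => [|c m f _ _ [d [g [d0 E]]]].
  by exists 1, 0; rewrite oner_neq0 scaler0 rmorph0.
pose a := \n_(repr c); pose b := \d_(repr c).
have b0 : b != 0 by exact: denom_ratioP.
exists (b * d), ((d * a) *: 'X_[m] + b *: g); split; first by rewrite mulf_neq0.
rewrite scalerDr [in RHS]rmorphD /= !map_mpolyZ map_mpolyX -E.
rewrite !scalerA !tofracM; congr (_ *: _ + _).
rewrite {1}[c]fracE -/a -/b [tofrac b * _]mulrC mulrACA.
by rewrite divff ?tofrac_eq0 // mulr1 -tofracM.
Qed.

Lemma emb_inj : injective emb.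
Proof.
apply: raddf_inj => f f0; have [d [g [d0 E]]] := common_denom f.
have : emb (tofrac d *: f) = 0 by rewrite -mul_mpolyC rmorphM f0 mulr0.
rewrite E emb_map => /eqP; rewrite tofrac_eq0 => /eqP g0.
move/eqP: E; rewrite g0 rmorph0 scaler_eq0 tofrac_eq0 (negPf d0) /=.
by move/eqP.
Qed.

(** * Graded submodules *)

(** The additive subgroups of [F[X]] that are graded for the [X]-degree are those
of this form, [C m] being the group of coefficients allowed at [X^m]. *)
Definition coefset (C : 'X_{1..n} -> set F) : set K :=
  [set x | exists f, x = emb f /\ forall m, C m f@_m].

Lemma coefsetE C f : coefset C (emb f) <-> forall m, C m f@_m.
Proof. by split=> [[g [/emb_inj -> ]]|Cf] //; exists f. Qed.

Lemma emb_coefE f :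
  emb f = \sum_(m <- msupp f) emb (f@_m *: 'X_[m]).
Proof. by rewrite -rmorph_sum /= -mpolyE. Qed.

Lemma mcoef_mul_closed (C D I : 'X_{1..n} -> set F) f g :
    (forall m, I m 0) -> (forall m a b, I m a -> I m b -> I m (a + b)) ->
    (forall m k a b, C m a -> D k b -> I (m + k)%MM (a * b)) ->
    (forall m, C m f@_m) -> (forall m, D m g@_m) ->
  forall m, I m (f * g)@_m.
Proof.
move=> I0 ID IM Cf Dg m; rewrite mcoeffM; apply: big_ind => //.
  by move=> a b; exact: ID.
by move=> i /eqP mE; have := IM _ _ _ _ (Cf i.1) (Dg i.2); rewrite -mE.
Qed.

Lemma homogeneous_monomial a m : homogeneous gr (emb (a *: 'X_[m])).
Proof.
have b0 : \d_(repr a) != 0 by exact: denom_ratioP.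
exists (mdegZ m), (mdegZ m), 0, (\n_(repr a) *: 'X_[m]), ((\d_(repr a))%:MP).
split.
- by right; exists \n_(repr a), m; split=> // i; rewrite ffunE.
- right; exists \d_(repr a), 0%MM; split=> [i|].
    by rewrite ffunE mnm0E.
  by rewrite mpolyX0 -mul_mpolyC mulr1.
- by rewrite mpolyC_eq0.
- by rewrite subr0.
- rewrite -!emb_map map_mpolyZ map_mpolyX /= map_mpolyC embC.
  rewrite -!mul_mpolyC !rmorphM /= !embC [in LHS](fracE a) fmorph_div /=.
  by rewrite mulrAC.
Qed.

(** A homogeneous fraction [a / b] which is a polynomial [f] is a single monomial:
[b] is some [c X^u], and all monomials of [f] times [X^u] have the degree
of [a]. *)
Lemma homogeneous_mcoeff f m k :
  homogeneous gr (emb f) -> f@_m != 0 -> f@_k != 0 -> m = k.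
Proof.
move=> [_ [d [e [a [b [/mpoly_compP da eb b0 _ E]]]]]].
case: eb => [b00|[c [u [_ bE]]]]; first by rewrite b00 eqxx in b0.
have c0 : c != 0 by apply: contra_neq b0 => c0; rewrite bE c0 scale0r.
have E' : f * (tofrac c *: 'X_[u]) = map_mpoly (@tofrac A) a.
  apply: emb_inj; rewrite emb_map -(map_mpolyX (@tofrac A)) -map_mpolyZ -bE.
  by rewrite rmorphM /= emb_map E divfK ?tofrac_eq0.
have supp v : f@_v != 0 -> d = mdegZ (u + v)%MM.
  move=> fv; apply: da; rewrite -tofrac_eq0 -mcoeff_map_mpoly -E'.
  by rewrite -scalerAr mcoeffZ mcoeffMX mulf_neq0 ?tofrac_eq0.
move=> fm fk; apply: (@addmI _ u); apply: (can_inj (@mdegZK n)).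
by rewrite -!supp.
Qed.

Lemma coefset_graded C : (forall m, C m 0) -> is_graded gr (coefset C).
Proof.
move=> C0 _ [f [-> Cf]].
exists [seq emb (f@_m *: 'X_[m]) | m <- msupp f].
rewrite big_map -emb_coefE; split=> // _ /mapP[m _ ->].
split; last exact: homogeneous_monomial.
apply/coefsetE => k; rewrite mcoeffZ mcoeffX.
by case: eqP => [<-|_]; rewrite ?mulr1 // mulr0.
Qed.

(** [is_graded] provides some decomposition into homogeneous elements of [P],
possibly with repeated degrees; the monomials of [f] are partial sums of it. *)
Lemma graded_components P f : is_graded gr P -> P `<=` range emb ->
    P 0 -> (forall x y, P x -> P y -> P (x + y)) ->
  P (emb f) <-> forall m, P (emb (f@_m *: 'X_[m])).
Proof.
move=> gP PT P0 PD; split=> [Pf m|Pf]; last first.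
  by rewrite emb_coefE; apply: big_ind => // m _; exact: PD.
have [s [sP fE]] := gP _ Pf.
(* The homogeneous summands, pulled back to polynomials. *)
have {sP} : exists t : seq FX, s = map emb t /\
    forall g, g \in t -> P (emb g) /\ homogeneous gr (emb g).
  elim: s sP {fE} => [|y s IH] sP; first by exists [::].
  have [|t [-> tP]] := IH; first by move=> z zs; apply: sP; rewrite inE zs orbT.
  have [Py hy] := sP y (mem_head _ _).
  have [g _ gy] := PT _ Py; exists (g :: t); rewrite /= gy; split=> // h.
  by rewrite inE => /orP[/eqP ->|/tP //]; rewrite gy.
move=> [t [sE tP]]; move: fE; rewrite sE big_map -rmorph_sum => /emb_inj ->.
rewrite /= raddf_sum scaler_suml rmorph_sum /= big_seq.
apply: big_ind => //; move=> g /tP [Pg hg].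
have [->|gm] := eqVneq g@_m 0; first by rewrite scale0r rmorph0.
suff -> : g@_m *: 'X_[m] = g by [].
apply/mpolyP => k; rewrite mcoeffZ mcoeffX.
case: eqP => [<-|mk]; rewrite ?mulr1 // mulr0; apply/esym/eqP/negPn/negP.
by move=> /(homogeneous_mcoeff hg gm).
Qed.

(** * Monomial ideals of S[X] *)

Definition poly_over S : set K := coefset (fun=> S).

Definition meets E (m : 'X_{1..n}) := [exists i, E i && (0 < m i)%N].

(** The ideal of [S[X]] generated by [p] and the variables with index in [E]. *)
Definition mono_ideal S p E : set K :=
  coefset (fun m => if meets E m then S else p).

Lemma meets0 E : meets E 0%MM = false.
Proof. by apply/existsP => -[i]; rewrite mnm0E andbF. Qed.

Lemma meetsD E m k : meets E (m + k)%MM = meets E m || meets E k.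
Proof.
apply/existsP/orP => [[i /andP[Ei]]|[] /existsP[i /andP[Ei mi]]].
- rewrite mnmDE addn_gt0 => /orP[mi|ki]; [left|right];
    by apply/existsP; exists i; rewrite Ei.
- by exists i; rewrite Ei mnmDE addn_gt0 mi.
- by exists i; rewrite Ei mnmDE addn_gt0 mi orbT.
Qed.

Lemma base_ring_mpoly : base_ring {mpoly A[n]} = poly_over (base_ring A).
Proof.
apply/seteqP; split=> [_ [g _ <-]|_ [f [-> Af]]].
  rewrite -emb_map; apply/coefsetE => m.
  by rewrite mcoeff_map_mpoly; exists g@_m.
pose a m := projT1 (cid2 (Af m)).
have aE m : tofrac (a m) = f@_m by rewrite /a; case: cid2.
exists (\sum_(m <- msupp f) a m *: 'X_[m]) => //.
rewrite -emb_map; congr emb; rewrite rmorph_sum /= [RHS]mpolyE.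
by apply: eq_bigr => m _; rewrite map_mpolyZ map_mpolyX /= aE.
Qed.

Lemma base_ring_subring (R : idomainType) : is_subring (base_ring R).
Proof.
split; first by exists 1; rewrite ?tofrac1.
- by move=> _ _ [a _ <-] [b _ <-]; exists (a - b); rewrite ?tofracB.
- by move=> _ _ [a _ <-] [b _ <-]; exists (a * b); rewrite ?tofracM.
Qed.

Section OverSubring.
Variable S : set F.
Hypothesis rS : is_subring S.

Lemma poly_over_subring : is_subring (poly_over S).
Proof.
have [S1 SB SM] := rS; split.
- rewrite -(rmorph1 (@emb)); apply/coefsetE => m; rewrite mcoeff1.
  by case: (m == 0%MM) => //; exact: subring0.
- move=> _ _ [f [-> Sf]] [g [-> Sg]]; rewrite -rmorphB; apply/coefsetE => m.
  by rewrite mcoeffB; exact: SB.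
- move=> _ _ [f [-> Sf]] [g [-> Sg]]; rewrite -rmorphM; apply/coefsetE.
  apply: (@mcoef_mul_closed (fun=> S) (fun=> S) (fun=> S)) => //.
  + by move=> _; exact: subring0.
  + by move=> _ a b; exact: subringD.
Qed.

Lemma poly_over_monomial c m : S c -> poly_over S (emb (c *: 'X_[m])).
Proof.
move=> Sc; apply/coefsetE => k; rewrite mcoeffZ mcoeffX.
by case: (m == k); rewrite ?mulr1 ?mulr0 //; exact: subring0.
Qed.

Lemma poly_over_const c : poly_over S (emb c%:MP) <-> S c.
Proof.
split=> [/coefsetE/(_ 0%MM)|Sc]; first by rewrite mcoeffC eqxx mulr1.
by rewrite -[_%:MP]mulr1 -mpolyX0 mul_mpolyC; exact: poly_over_monomial.
Qed.

Lemma mono_ideal_const p E c : p 0 ->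
  mono_ideal S p E (emb c%:MP) <-> p c.
Proof.
move=> p0; split=> [/coefsetE/(_ 0%MM)|pc].
  by rewrite meets0 mcoeffC eqxx mulr1.
apply/coefsetE => m; rewrite mcoeffC.
have [->|_] := eqVneq m 0%MM; first by rewrite meets0 mulr1.
by rewrite mulr0; case: ifP => // _; exact: subring0.
Qed.

Lemma mono_idealP p E : is_ideal S p ->
  is_ideal (poly_over S) (mono_ideal S p E).
Proof.
have [S1 SB SM] := rS; move=> [pS p0 pD pM]; split.
- move=> _ [f [-> pf]]; apply/coefsetE => m.
  by have := pf m; case: ifP => // _ /pS.
- rewrite -(rmorph0 (@emb)); apply/coefsetE => m; rewrite mcoeff0.
  by case: ifP => // _; exact: subring0.
- move=> _ _ [f [-> pf]] [g [-> pg]]; rewrite -rmorphD; apply/coefsetE => m.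
  rewrite mcoeffD; have := pf m; have := pg m.
  by case: ifP => _ ? ?; [exact: subringD|exact: pD].
- move=> _ _ [f [-> Sf]] [g [-> pg]]; rewrite -rmorphM; apply/coefsetE.
  pose D m := if meets E m then S else p.
  apply: (@mcoef_mul_closed (fun=> S) D D) => //; rewrite /D.
  + by move=> m; case: ifP => // _; exact: subring0.
  + by move=> m a b; case: ifP => _; [exact: subringD|exact: pD].
  + move=> m k a b Sa; rewrite meetsD; case: (meets E k).
      by rewrite orbT; exact: SM.
    rewrite orbF => pb; case: ifP => _; last exact: pM.
    by apply: SM => //; exact: pS.
Qed.

Lemma mono_ideal_graded p E : is_ideal S p -> is_graded gr (mono_ideal S p E).
Proof.
move=> [_ p0 _ _]; apply: coefset_graded => m.
by case: ifP => // _; exact: subring0.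
Qed.

Lemma mono_ideal_proper p E : is_proper_ideal S p ->
  is_proper_ideal (poly_over S) (mono_ideal S p E).
Proof.
move=> /(ideal_properP _ rS)[ip p1].
apply/(ideal_properP _ poly_over_subring); split; first exact: mono_idealP.
by rewrite -(rmorph1 (@emb)) -mpolyC1 mono_ideal_const //; case: ip.
Qed.

(** The quotient is [(S/p)[X_i | i not in E]], a domain since leading coefficients
multiply.  Concretely, removing from [f] its terms lying in the ideal leaves a
polynomial [core f], congruent to [f] modulo the ideal, whose nonzero coefficients
are all outside [p] at monomials free of [E].  If neither core vanishes, the
leading coefficient of the product of the cores is a product of two elements
outside [p]. *)
Lemma mono_ideal_prime p E : is_prime_ideal S p ->
  is_prime_ideal (poly_over S) (mono_ideal S p E).
Proof.
move=> [pp primep]; split; first exact: mono_ideal_proper.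
have [ip _] := pp; have [pS p0 pD pM] := ip.
have [JT J0 JD JM] := mono_idealP E ip.
pose J := mono_ideal S p E; rewrite -/J in JT J0 JD JM *.
pose bad f m := ~~ meets E m && ~~ `[< p f@_m >].
pose core f := \sum_(m <- msupp f) (bad f m)%:R * f@_m *: 'X_[m].
have coreE f m : (core f)@_m = (bad f m)%:R * f@_m.
  rewrite /core raddf_sum /=; have [mf|mf] := boolP (m \in msupp f).
    rewrite (bigD1_seq m) //= mcoeffZ mcoeffX eqxx mulr1 big1 ?addr0 // => k km.
    by rewrite mcoeffZ mcoeffX (negPf km) mulr0.
  rewrite (memN_msupp_eq0 mf) mulr0 big_seq big1 // => k kf.
  rewrite mcoeffZ mcoeffX; case: eqP => [km|_]; last by rewrite mulr0.
  by rewrite -km kf in mf.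
have coreJ f : (forall m, S f@_m) -> J (emb (f - core f)).
  move=> Sf; apply/coefsetE => m; rewrite mcoeffB coreE /bad.
  case: ifP => _ /=; first by rewrite mul0r subr0.
  by case: asboolP => pfm; rewrite ?mul0r ?mul1r ?subr0 ?subrr.
have core_lead f : core f != 0 ->
    exists m, [/\ m = mlead (core f), mleadc (core f) = f@_m & bad f m].
  move=> cf; exists (mlead (core f)); rewrite coreE.
  move: cf; rewrite -mleadc_eq0 coreE.
  by case: (bad f _); rewrite ?mul1r // mul0r eqxx.
move=> _ _ [f [-> Sf]] [g [-> Sg]] Jfg.
have [cf0|/core_lead[m [mE mf badm]]] := eqVneq (core f) 0.
  by left; rewrite -[f]subr0 -cf0; exact: coreJ.
have [cg0|/core_lead[k [kE kg badk]]] := eqVneq (core g) 0.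
  by right; rewrite -[g]subr0 -cg0; exact: coreJ.
exfalso.
have JN x : J x -> J (- x).
  move=> Jx; rewrite -mulN1r; apply: JM => //; rewrite -sub0r.
  have [T1 TB _] := poly_over_subring; apply: (TB) => //.
  exact: subring0 poly_over_subring.
have Score h : (forall m, S h@_m) -> poly_over S (emb (core h)).
  move=> Sh; apply/coefsetE => u; rewrite coreE.
  by case: (bad h u); rewrite ?mul1r ?mul0r //; exact: subring0.
have : J (emb (core f * core g)).
  have -> :
    core f * core g = f * g - (g * (f - core f) + core f * (g - core g)).
    rewrite !mulrBr [g * f]mulrC [g * core f]mulrC.
    by rewrite addrA subrK opprB addrC subrK.
  rewrite rmorphB rmorphD !rmorphM /=; apply: (JD) => //; apply: JN.
  apply: JD; apply: JM; try exact: coreJ; last exact: Score.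
  exact/coefsetE.
move/coefsetE/(_ (m + k)%MM).
move: badm badk => /andP[Em /asboolP pm] /andP[Ek /asboolP pk].
rewrite meetsD (negPf Em) (negPf Ek) {1}mE {1}kE mleadcM mf kg.
by move/primep => [] //.
Qed.

(** * Graded primes of S[X] *)

Definition const_part P : set F := [set c | P (emb c%:MP)].

Lemma const_part_proper P : is_proper_ideal (poly_over S) P ->
  is_proper_ideal S (const_part P).
Proof.
move=> /(ideal_properP _ poly_over_subring)[[PT P0 PD PM] P1].
apply/(ideal_properP _ rS); rewrite /const_part; split; last first.
  by rewrite /= mpolyC1 rmorph1.
split=> /=.
- by move=> c /PT; rewrite poly_over_const.
- by rewrite mpolyC0 rmorph0.
- by move=> a b Pa Pb; rewrite mpolyCD rmorphD; exact: PD.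
- move=> a b Sa Pb; rewrite mpolyCM rmorphM; apply: PM => //.
  exact/poly_over_const.
Qed.

Lemma const_part_prime P : is_prime_ideal (poly_over S) P ->
  is_prime_ideal S (const_part P).
Proof.
move=> [pP primeP]; split; first exact: const_part_proper.
move=> a b Sa Sb; rewrite /const_part /= mpolyCM rmorphM.
by move=> /primeP; apply; exact/poly_over_const.
Qed.

Definition vars_in P : pred 'I_n := fun i => `[< P (emb 'X_i) >].

Lemma poly_over_range : poly_over S `<=` range emb.
Proof. by move=> _ [f [-> _]]; exists f. Qed.

(** As [P] is graded it suffices to compare monomials.  By primality [c X^m] is in
[P] iff [c] or some variable dividing [X^m] is. *)
Lemma gr_prime_mono P : is_gr_prime gr (poly_over S) P ->
  P = mono_ideal S (const_part P) (vars_in P).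
Proof.
have [S1 _ _] := rS.
move=> [[pP primeP] gP]; have [iP _] := pP; have [PT P0 PD PM] := iP.
have [_ P1] := (ideal_properP P poly_over_subring).1 pP.
have PX m : P (emb 'X_[m]) <-> meets (vars_in P) m.
  split=> [|/existsP[i /andP[/asboolP Pi mi]]]; last first.
    have -> : m = ((m - U_(i)) + U_(i))%MM.
      rewrite submK //; apply/mnm_lepP => j.
      by rewrite mnm1E; case: eqP => [<-|].
    rewrite mpolyXD rmorphM; apply: PM => //.
    by rewrite -['X_[_]]scale1r; exact: poly_over_monomial.
  rewrite mpolyXE_id rmorph_prod /= => Pm; apply: contrapT => Em.
  (* The complement of [P] is multiplicative, so if no variable dividing [X^m]
     is in [P], neither is [X^m]. *)
  pose outside x := poly_over S x /\ ~ P x.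
  have outside1 : outside 1 by split=> //; case: poly_over_subring.
  have outsideM x y : outside x -> outside y -> outside (x * y).
    move=> [Tx Px] [Ty Py]; split; last by move=> /(primeP _ _ Tx Ty)[].
    by have [_ _ TM] := poly_over_subring; exact: TM.
  suff [] : outside (\prod_(i < n) emb ('X_i ^+ m i)) by [].
  apply: big_ind => // i _; rewrite rmorphXn /=.
  have [->|mi] := posnP (m i); first by rewrite expr0.
  have outsideX : outside (emb 'X_i).
    split; first by rewrite -['X_i]scale1r; exact: poly_over_monomial.
    move=> Pi; apply: Em; apply/existsP; exists i; rewrite mi andbT.
    exact/asboolP.
  by elim: (m i) => [|k IH]; rewrite ?expr0 // exprS; exact: outsideM.
suff H f : P (emb f) <-> mono_ideal S (const_part P) (vars_in P) (emb f).
  apply/seteqP; split=> x.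
    move=> Px; have [f _ fx] := poly_over_range (PT _ Px).
    by rewrite -fx in Px *; apply/H.
  by case=> f [-> pf]; apply/H/coefsetE.
have PX' : P `<=` range emb by exact: subset_trans PT poly_over_range.
rewrite /mono_ideal coefsetE (graded_components f gP PX' P0 PD).
have split_mono c m : emb (c *: 'X_[m]) = emb c%:MP * emb 'X_[m].
  by rewrite -mul_mpolyC rmorphM.
split=> Pf m; move: (Pf m); rewrite ?split_mono.
  move=> Pfm; have := PT _ Pfm; rewrite -split_mono => /coefsetE/(_ m).
  rewrite mcoeffZ mcoeffX eqxx mulr1 => Sfm; case: ifPn => // /negP Em.
  have [||//|] := primeP _ _ _ _ Pfm; first exact/poly_over_const.
    by rewrite -['X_[m]]scale1r; exact: poly_over_monomial.
  by move/PX.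
case: ifP => [/PX Pm Sfm|_ pfm].
  by apply: PM => //; exact/poly_over_const.
rewrite mulrC; apply: PM => //.
by rewrite -['X_[m]]scale1r; exact: poly_over_monomial.
Qed.

(** * Graded maximal ideals of S[X] *)

(** With all variables in the ideal only the constant term is constrained, and the
constant term of an element of a graded ideal is again in that ideal. *)
Lemma sub_mono_ideal P p : is_ideal (poly_over S) P -> is_graded gr P ->
  const_part P `<=` p -> P `<=` mono_ideal S p predT.
Proof.
move=> [PT P0 PD PM] gP Pp x Px; have [f _ fx] := poly_over_range (PT _ Px).
have PX : P `<=` range emb by exact: subset_trans PT poly_over_range.
move: Px (PT _ Px); rewrite -{x}fx => /(graded_components _ gP PX P0 PD) Pf Tf.
apply/coefsetE => m; case: ifPn => [_|Em].
  by have /coefsetE := Tf.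
have -> : m = 0%MM.
  apply/mnmP => i; rewrite mnm0E; apply/eqP; rewrite -leqn0 leqNgt.
  by apply: contra Em => mi; apply/existsP; exists i.
by apply: Pp; rewrite /const_part /= -[_%:MP]mulr1 -mpolyX0 mul_mpolyC.
Qed.

(** The constants of a graded maximal ideal form a maximal ideal of [S]: a larger
proper ideal [J] would make the ideal generated by [J] and the variables larger.
Hence uniqueness follows from that in [S], with no need to embed a proper ideal
in a maximal one. *)
Lemma poly_over_gr_local : is_local S -> is_gr_local gr (poly_over S).
Proof.
move=> [M [[pM maxM] uniqM]].
have iM : is_ideal S M by case: pM.
have M0 : M 0 by case: iM.
pose N := mono_ideal S M predT.
have pN : is_proper_ideal (poly_over S) N by exact: mono_ideal_proper.
have gN : is_graded gr N by exact: mono_ideal_graded.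
exists N; split.
  split=> // I pI gI NI; have [iI _] := pI.
  apply/seteqP; split=> //; apply: sub_mono_ideal => //.
  rewrite (maxM (const_part I)) //; first exact: const_part_proper.
  by move=> c Mc; apply: NI; apply/mono_ideal_const.
move=> N' [pN' gN' maxN']; have [iN' _] := pN'.
rewrite /N; suff -> : M = const_part N'.
  apply: maxN'; last exact: sub_mono_ideal.
  - exact/mono_ideal_proper/const_part_proper.
  - by apply: mono_ideal_graded; have [] := const_part_proper pN'.
apply: uniqM; split=> [|J pJ NJ]; first exact: const_part_proper.
have [iJ _] := pJ; have J0 : J 0 by case: iJ.
have JN' : mono_ideal S J predT = N'.
  apply: maxN'; [exact: mono_ideal_proper|exact: mono_ideal_graded|].
  exact: sub_mono_ideal.
by apply/seteqP; split=> c; rewrite -JN' /const_part /= mono_ideal_const.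
Qed.

End OverSubring.

(** * Transfer between A inside S and A[X] inside S[X] *)

Section Overring.
Variable S : set F.
Hypothesis rS : is_subring S.
Hypothesis AS : base_ring A `<=` S.

Lemma poly_over_gr_overring : is_gr_overring gr (poly_over S).
Proof.
split.
- split; first exact: poly_over_subring.
  rewrite base_ring_mpoly => _ [f [-> Af]].
  by apply/coefsetE => m; exact: AS.
- move=> _ [f [-> _]]; have [d [g [d0 E]]] := common_denom f.
  exists g, d%:MP; split; last 1 first.
  + rewrite -emb_map -E -mul_mpolyC rmorphM /= embC scalar_tofrac mulrC.
    by rewrite mulKf // tofrac_eq0 mpolyC_eq0.
  + exists 0; right; exists d, 0%MM; rewrite mpolyX0 -mul_mpolyC mulr1.
    by split=> // i; rewrite ffunE mnm0E.
  + by rewrite mpolyC_eq0.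
- by apply: coefset_graded => _; exact: subring0.
Qed.

(** Writing [P] and [Q'] as the ideals of pairs [(p0, E)] and [(q', E')], one has
[E] included in [E'] because variables lie in [A[X]]; going down from [q'] to a
prime [p] over [p0] gives the graded prime of the pair [(p, E)]. *)
Lemma poly_over_gr_going_down :
  going_down (base_ring A) S -> gr_going_down gr (poly_over S).
Proof.
move=> GD P Q Q'; rewrite base_ring_mpoly => gP gQ gQ' PQ Q'Q.
have rA := base_ring_subring A.
have PE := gr_prime_mono rA gP; have Q'E := gr_prime_mono rS gQ'.
have [[pP primeP] _] := gP; have [primeQ _] := gQ; have [primeQ' _] := gQ'.
have constP := const_part_prime rA (conj pP primeP).
have constQ' := const_part_prime rS primeQ'.
have constPQ : const_part P `<=` const_part Q by move=> c; exact: PQ.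
have constQ'A : const_part Q' `&` base_ring A = const_part Q.
  by rewrite -Q'Q; apply/seteqP; split=> c [Q'c] /(poly_over_const rA).
have [p [pp pQ' pA]] :=
  GD _ _ _ constP (const_part_prime rA primeQ) constQ' constPQ constQ'A.
exists (mono_ideal S p (vars_in P)).
have ip : is_ideal S p by case: pp => -[].
have [pS p0 _ _] := ip.
split.
- by split; [exact: mono_ideal_prime|exact: mono_ideal_graded].
- move=> _ [f [-> pf]]; rewrite Q'E; apply/coefsetE => m.
  have := pf m; case: ifP => [EP Sfm|_ pfm].
    suff -> : meets (vars_in Q') m by [].
    move/existsP: EP => [i /andP[/asboolP Pi mi]].
    apply/existsP; exists i; rewrite mi andbT; apply/asboolP.
    by move/PQ: Pi; rewrite -Q'Q => -[].
  by case: ifP => _; [exact: pS|exact: pQ'].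
rewrite [RHS]PE; apply/seteqP; split=> [_ [[f [-> pf]] /coefsetE Af]|].
  apply/coefsetE => m; have := pf m; case: ifP => // _ pfm.
  by rewrite -pA.
move=> _ [f [-> Pf]]; split; apply/coefsetE => m; move: (Pf m);
  case: ifP => // _.
- exact: AS.
- by rewrite -pA => -[].
- by rewrite -pA => -[].
Qed.

(** The inverse of [w] in [W] is [1 / w], which is in [S[X]]; units of [F[X]] are
constants.  So if [s] in [S] is [r / w], then [w] and [r = s w] are constants, and
[s] is a fraction over [A]. *)
Lemma poly_over_localization :
  is_localization (base_ring {mpoly A[n]}) (poly_over S) ->
  is_localization (base_ring A) S.
Proof.
rewrite base_ring_mpoly => -[W [[WA W1 WM] W0 TE]].
have rA := base_ring_subring A; have [A1 _ AM] := rA.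
have inT r w : poly_over (base_ring A) r -> W w -> poly_over S (r / w).
  by move=> Ar Ww; rewrite TE; exists r, w.
exists [set c | W (emb c%:MP)]; split.
- split=> /=.
  + by move=> c /WA; rewrite poly_over_const.
  + by rewrite mpolyC1 rmorph1.
  + by move=> a b Wa Wb; rewrite mpolyCM rmorphM; exact: WM.
- by rewrite /= mpolyC0 rmorph0.
apply/seteqP; split=> [s Ss|_ [a [w [Aa Ww ->]]]]; last first.
  have := inT _ _ ((poly_over_const rA a).2 Aa) Ww.
  by rewrite !embC -fmorph_div /= -embC => /(poly_over_const rS).
have : poly_over S (emb s%:MP) by exact/poly_over_const.
rewrite TE => -[r [w [Ar Ww sE]]].
have w0 : w != 0 by apply: contra_notN W0 => /eqP <-.
have [f [wf Af]] := WA _ Ww.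
have [T1 _ _] := poly_over_subring rA; have [g [wg _]] := inT 1 w T1 Ww.
have fg1 : g * f = 1.
  by apply: emb_inj; rewrite rmorphM rmorph1 /= -wg -wf mul1r mulVf.
have /andP[/eqP fc _] := mpoly_intro_unit fg1.
move: wf; rewrite {}fc; set c := f@_0 => wf.
have c0 : c != 0.
  by apply: contra_neq w0 => c0; rewrite wf c0 mpolyC0 rmorph0.
exists (s * c), c; split; last by rewrite mulfK.
- apply/(poly_over_const rA); rewrite mpolyCM rmorphM /= sE -wf.
  by rewrite divfK.
- by rewrite /= -wf.
Qed.

End Overring.

End Polynomials.

Theorem corollary2p37 (A : idomainType) (n : nat) :
  gr_perinormal (mpoly_grading A n) -> perinormal A.
Proof.
move=> perA S [rS AS] locS gdS.
apply: (@poly_over_localization A n) => //; apply: perA.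
- exact: poly_over_gr_overring.
- exact: poly_over_gr_local.
- exact: poly_over_gr_going_down.
Qed.
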